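(* Let $\delta\in\mathbb{C}$. The birational transformation $\varphi_0$ $$x=u,\qquad y=\frac{du}{dt}+\frac{3}{2}(\sqrt5-1)u^2,\qquad z=\frac{d^2u}{dt^2}+3(\sqrt5-1)u\frac{du}{dt}$$ takes the Chazy IX equation $$\frac{d^3u}{dt^3}=54u^4+72u^2\frac{du}{dt}+12\left(\frac{du}{dt}\right)^2+\delta$$ to the system $$\frac{dx}{dt}=-\frac32(\sqrt5-1)x^2+y,\qquad \frac{dy}{dt}=z,\qquad \frac{dz}{dt}=3(\sqrt5+3)y^2+3(\sqrt5-1)xz+\delta .$$
   Context: $u$ is an unknown complex function of the complex variable $t$. A scalar third-order equation for $u$ is identified with a first-order system in $(u,u',u'')$. That a birational transformation ''takes'' the equation to the system means that it is a birational map from $(u,u',u'')$-space to $(x,y,z)$-space mapping solutions of the equation to solutions of the system, and conversely via the inverse map. *)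

(* Defs.v *)
From HB Require Import structures.
From mathcomp Require Import all_boot all_order all_algebra.
From mathcomp Require Import all_classical all_reals all_analysis.
From mathcomp Require Export complex.
(* The notations of [mpoly] clash with those of the analysis library. *)
From mathcomp Require Import -(notations) mpoly.

Set Implicit Arguments.
Unset Strict Implicit.
Unset Printing Implicit Defensive.

Import Order.TTheory GRing.Theory Num.Theory.
Import numFieldNormedType.Exports.

Local Open Scope ring_scope.
Local Open Scope classical_set_scope.

(* The complex numbers, packed at [numClosedFieldType] so that the topology and
   the derivatives which the analysis library attaches to any [numFieldType]
   are found: [derivable f t 1] and [f^`()] are then complex
   differentiability and the complex derivative. *)
Definition Cx (R : realType) : numClosedFieldType := R[i].

Section Birational.
Variable K : fieldType.

Definition poly3 : idomainType := mpoly 3 K.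

Definition ratfun3 : fieldType := {fraction poly3}.

Definition point3 : Type := 3.-tuple K.

Definition coord3 (i : 'I_3) : ratfun3 :=
  tofrac (mpolyX K (mnm1 i) : poly3).

Definition const3 (c : K) : ratfun3 := tofrac (mpolyC 3 c : poly3).

Definition peval (p : point3) (a : poly3) : K := meval (tnth p) a.

(* The rational function [f] is regular at [p], with value [c] there: some
   representation of [f] as a quotient has a denominator nonzero at [p]. *)
Definition has_value (f : ratfun3) (p : point3) (c : K) : Prop :=
  exists a b : poly3,
    [/\ f = tofrac a / tofrac b, peval p b != 0 & c = peval p a / peval p b].

Definition ratmap3 : Type := 3.-tuple ratfun3.

Definition maps_to (phi : ratmap3) (p q : point3) : Prop :=
  forall i : 'I_3, has_value (tnth phi i) p (tnth q i).

(* [psi \o phi] is defined and equal to the identity on a nonempty Zariski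
   open set (over an infinite field, as a nonzero polynomial [h] then has a
   nonzero value). *)
Definition generic_left_inverse (phi psi : ratmap3) : Prop :=
  exists2 h : poly3, h != 0 &
    forall p : point3, peval p h != 0 ->
      exists2 q : point3, maps_to phi p q & maps_to psi q p.

Definition birational_inverses (phi psi : ratmap3) : Prop :=
  generic_left_inverse phi psi /\ generic_left_inverse psi phi.

End Birational.

Section Equations.
Variable R : realType.
Local Notation C := (Cx R).

Definition chazyIX (delta : C) (D : set C) (u : C -> C) : Prop :=
  let u' := u^`() in let u'' := u^`(2) in let u''' := u^`(3) in
  forall t, D t ->
    [/\ derivable u t 1, derivable u' t 1, derivable u'' t 1 &
        u''' t = 54 * u t ^+ 4 + 72 * u t ^+ 2 * u' t + 12 * u' t ^+ 2 + delta].

Definition jet_chazyIX (delta : C) (D : set C) (U : C -> point3 C) : Prop :=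
  exists2 u : C -> C, chazyIX delta D u &
    forall t, D t -> U t = [tuple u t; u^`() t; u^`(2) t].

(* [sqrtC 5] is the positive square root. *)
Definition system_xyz (delta : C) (D : set C) (V : C -> point3 C) : Prop :=
  exists x y z : C -> C,
    (forall t, D t -> V t = [tuple x t; y t; z t]) /\
    forall t, D t ->
    [/\ is_derive t 1 x (- (3 / 2) * (sqrtC 5 - 1) * x t ^+ 2 + y t),
        is_derive t 1 y (z t) &
        is_derive t 1 z (3 * (sqrtC 5 + 3) * y t ^+ 2
                         + 3 * (sqrtC 5 - 1) * x t * z t + delta)].

Definition phi0 : ratmap3 C :=
  let u := coord3 C (@Ordinal 3 0 isT) in
  let u' := coord3 C (@Ordinal 3 1 isT) in
  let u'' := coord3 C (@Ordinal 3 2 isT) in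
  [tuple u;
         u' + const3 (3 / 2 * (sqrtC 5 - 1) : C) * u ^+ 2;
         u'' + const3 (3 * (sqrtC 5 - 1) : C) * u * u'].

(* Solutions are functions on an arbitrary open set [D] of the [t]-plane; only
   their values on [D] matter.  The map must be regular along every
   solution. *)
Definition maps_solutions (phi : ratmap3 C)
    (E F : set C -> (C -> point3 C) -> Prop) : Prop :=
  forall (D : set C) (U : C -> point3 C), open D -> E D U ->
    exists2 V : C -> point3 C,
      F D V & forall t, D t -> maps_to phi (U t) (V t).

End Equations.

(* Main.v *)
Require Import Defs.
From mathcomp Require Import all_boot all_order all_algebra.
From mathcomp Require Import all_classical all_reals all_analysis.
From mathcomp Require Import ring.
From mathcomp Require Import -(notations) mpoly.

(** With [a = 3/2 (sqrt 5 - 1)], the transformation is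
    [x = u], [y = u' + a u^2], [z = u'' + 2 a u u'].  Its components are
    triangular in [u, u', u''], so it is a polynomial automorphism of affine
    3-space, with inverse
    [u = x], [u' = y - a x^2], [u'' = z - 2 a x (y - a x^2)]
    (lemmas [phi0_ptK] and [psi0_ptK]).

    The formula for [z] is the derivative of the one for [y], so the first two
    equations of the system merely say that [(x, y, z)] is the image of the jet
    [(u, u', u'')].  The last equation then carries the whole content: since
    [z' = u''' + 2 a u'^2 + 2 a u u''], it is the third-order equation exactly
    when
    [54 u^4 + 72 u^2 u' + 12 u'^2 + 2 a u'^2
       = 3 (sqrt 5 + 3) (u' + a u^2)^2 + 4 a^2 u^2 u'],
    and comparing coefficients of [u^4], [u^2 u'] and [u'^2] this follows from
    [(sqrt 5)^2 = 5]; see [chazy_rhsE]. *)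

Set Implicit Arguments.
Unset Strict Implicit.
Unset Printing Implicit Defensive.

Import Order.TTheory GRing.Theory Num.Theory.
Import numFieldNormedType.Exports.

Local Open Scope ring_scope.
Local Open Scope classical_set_scope.

(** * Values of rational functions *)

Section Values.
Variable K : fieldType.
Implicit Types (f g : ratfun3 K) (p : point3 K).

Lemma has_value_tofrac p (a : poly3 K) : has_value (tofrac a) p (peval p a).
Proof.
exists a, 1; split; first by rewrite rmorph1 divr1.
  by rewrite /peval rmorph1 oner_neq0.
by rewrite /peval rmorph1 divr1.
Qed.

Lemma has_value_coord p (i : 'I_3) : has_value (coord3 K i) p (tnth p i).
Proof. by have := has_value_tofrac p (mpolyX K (mnm1 i)); rewrite /peval mevalXU. Qed.

Lemma has_value_const p (c : K) : has_value (const3 c) p c.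
Proof. by have := has_value_tofrac p (mpolyC 3 c); rewrite /peval mevalC. Qed.

Lemma tofrac_neq0 p (b : poly3 K) : peval p b != 0 -> tofrac b != 0.
Proof.
by rewrite tofrac_eq0; apply: contra_neq => ->; rewrite /peval rmorph0.
Qed.

Lemma has_valueD f g p c d :
  has_value f p c -> has_value g p d -> has_value (f + g) p (c + d).
Proof.
move=> [a [b [-> b0 ->]]] [a' [b' [-> b'0 ->]]].
exists (a * b' + a' * b), (b * b'); split.
- rewrite tofracD !tofracM.
  exact: addf_div (tofrac_neq0 b0) (tofrac_neq0 b'0).
- by rewrite /peval rmorphM mulf_neq0.
- by rewrite /peval rmorphD !rmorphM addf_div.
Qed.

Lemma has_valueM f g p c d :
  has_value f p c -> has_value g p d -> has_value (f * g) p (c * d).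
Proof.
move=> [a [b [-> b0 ->]]] [a' [b' [-> b'0 ->]]].
exists (a * a'), (b * b'); split.
- by rewrite !tofracM; exact: mulf_div.
- by rewrite /peval rmorphM mulf_neq0.
- by rewrite /peval !rmorphM mulf_div.
Qed.

Lemma maps_to_tuple3 (f0 f1 f2 : ratfun3 K) p (c0 c1 c2 : K) :
  has_value f0 p c0 -> has_value f1 p c1 -> has_value f2 p c2 ->
  maps_to [tuple f0; f1; f2] p [tuple c0; c1; c2].
Proof. by move=> h0 h1 h2 [[|[|[|//]]] ?]; rewrite !(tnth_nth 0). Qed.

(** A pointwise left inverse, defined everywhere, is a generic one: the
    polynomial cutting out the exceptional locus can be taken to be [1]. *)
Lemma generic_left_inverse_total (phi psi : ratmap3 K) (F G : point3 K -> point3 K) :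
  (forall p, maps_to phi p (F p)) -> (forall p, maps_to psi p (G p)) ->
  cancel F G -> generic_left_inverse phi psi.
Proof.
move=> phiF psiG FK; exists 1; first exact: oner_neq0.
by move=> p _; exists (F p) => //; rewrite -{2}(FK p).
Qed.

Lemma point3_eta (p : point3 K) :
  p = [tuple tnth p (@Ordinal 3 0 isT); tnth p (@Ordinal 3 1 isT);
             tnth p (@Ordinal 3 2 isT)].
Proof.
by apply: eq_from_tnth => -[[|[|[|//]]] ?]; rewrite !(tnth_nth 0).
Qed.

Lemma tuple3_eq (c0 c1 c2 d0 d1 d2 : K) :
  c0 = d0 -> c1 = d1 -> c2 = d2 -> [tuple c0; c1; c2] = [tuple d0; d1; d2].
Proof. by move=> -> -> ->. Qed.

End Values.

(** * Derivatives *)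

Section Derivatives.
Variable K : numFieldType.

Lemma is_derive_scale_sqr (k : K) (f : K -> K) (t df : K) : is_derive t 1 f df ->
  is_derive t 1 (fun s => k * f s ^+ 2) (2 * k * f t * df).
Proof.
move=> hf; have h := is_deriveZ k (is_deriveX 2 hf).
by apply: (is_derive_eq h); rewrite /= /GRing.scale /=; ring.
Qed.

Lemma is_derive_scale_mul (k : K) (f g : K -> K) (t df dg : K) :
  is_derive t 1 f df -> is_derive t 1 g dg ->
  is_derive t 1 (fun s => k * f s * g s) (k * (df * g t + f t * dg)).
Proof.
move=> hf hg; have h := is_deriveM (is_deriveZ k hf) hg.
by apply: (is_derive_eq h); rewrite /= /GRing.scale /=; ring.
Qed.

Lemma is_derive_derivable (f : K -> K) (t : K) :
  derivable f t 1 -> is_derive t 1 f (f^`() t).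
Proof. by move=> df; apply: DeriveDef => //; rewrite derive1E. Qed.

Lemma derive1_val (f : K -> K) (t d : K) : is_derive t 1 f d -> f^`() t = d.
Proof. by move=> hf; rewrite derive1E derive_val. Qed.

(** [f^`()] is only known to be [df] on [D]; openness of [D] makes this an
    equality near [t], which is what differentiating once more requires. *)
Lemma is_derive_derive1 (D : set K) (f df : K -> K) (t d : K) :
  open D -> D t -> (forall s, D s -> is_derive s 1 f (df s)) ->
  is_derive t 1 df d -> is_derive t 1 f^`() d.
Proof.
move=> openD Dt hf; apply: near_eq_is_derive.
have : \near t, D t by exact: open_nbhs_nbhs.
by apply: filterS => s Ds; rewrite derive1E (@derive_val _ _ _ _ _ _ _ (hf s Ds)).
Qed.

End Derivatives.

(** * The inverse transformation *)

Section Transformation.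
Variable R : realType.
Local Notation C := (Cx R).
Local Notation i0 := (@Ordinal 3 0 isT).
Local Notation i1 := (@Ordinal 3 1 isT).
Local Notation i2 := (@Ordinal 3 2 isT).
Local Notation a := (3 / 2 * (sqrtC 5 - 1) : C).

Definition phi0_pt (p : point3 C) : point3 C :=
  let u := tnth p i0 in let u' := tnth p i1 in let u'' := tnth p i2 in
  [tuple u; u' + a * u ^+ 2; u'' + 2 * a * u * u'].

Definition psi0_pt (p : point3 C) : point3 C :=
  let x := tnth p i0 in let y := tnth p i1 in let z := tnth p i2 in
  let u' := y - a * x ^+ 2 in [tuple x; u'; z - 2 * a * x * u'].

Definition psi0 : ratmap3 C :=
  let x := coord3 C i0 in let y := coord3 C i1 in let z := coord3 C i2 in
  let u' := y + const3 (- a) * x ^+ 2 in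
  [tuple x; u'; z + const3 (- (2 * a)) * x * u'].

Lemma maps_to_phi0 p : maps_to (phi0 R) p (phi0_pt p).
Proof.
rewrite /phi0_pt.
have -> : 2 * a = 3 * (sqrtC 5 - 1).
  by move: (sqrtC 5 : C) => s; field.
apply: maps_to_tuple3; rewrite ?expr2;
  by do ![exact: has_value_coord | exact: has_value_const
         | apply: has_valueD | apply: has_valueM].
Qed.

Lemma maps_to_psi0 p : maps_to psi0 p (psi0_pt p).
Proof.
apply: maps_to_tuple3; rewrite ?expr2 -?mulNr;
  by do ![exact: has_value_coord | exact: has_value_const
         | apply: has_valueD | apply: has_valueM].
Qed.

Lemma phi0_ptK : cancel phi0_pt psi0_pt.
Proof.
move=> p; rewrite [RHS]point3_eta /phi0_pt /psi0_pt !(tnth_nth 0) /=.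
by apply: tuple3_eq; ring.
Qed.

Lemma psi0_ptK : cancel psi0_pt phi0_pt.
Proof.
move=> p; rewrite [RHS]point3_eta /phi0_pt /psi0_pt !(tnth_nth 0) /=.
by apply: tuple3_eq; ring.
Qed.

Lemma birational_phi0_psi0 : birational_inverses (phi0 R) psi0.
Proof.
split.
- exact: generic_left_inverse_total maps_to_phi0 maps_to_psi0 phi0_ptK.
- exact: generic_left_inverse_total maps_to_psi0 maps_to_phi0 psi0_ptK.
Qed.

(** * Transport of solutions *)

(** The right-hand side of the equation for [u'''], expressed through
    [y] and [z].  The last term is minus the derivative of [2 a u u'], so that
    the identity reads as [u''' = z' - (2 a u u')'] in both directions of the
    correspondence. *)
Lemma chazy_rhsE (delta u u' u'' : C) :
  let y := u' + a * u ^+ 2 in let z := u'' + 2 * a * u * u' in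
  54 * u ^+ 4 + 72 * u ^+ 2 * u' + 12 * u' ^+ 2 + delta =
  3 * (sqrtC 5 + 3) * y ^+ 2 + 3 * (sqrtC 5 - 1) * u * z + delta
  - 2 * a * (u' ^+ 2 + u * u'').
Proof.
move=> y z; rewrite /y /z; have := sqrtCK (5 : C).
by move: (sqrtC 5) => s hs; field: hs.
Qed.

Lemma phi0_maps_solutions (delta : C) :
  maps_solutions (phi0 R) (jet_chazyIX delta) (system_xyz delta).
Proof.
move=> D U openD [u hu UE].
exists (phi0_pt \o U); last by move=> t _; apply: maps_to_phi0.
exists u, (fun t => u^`()%classic t + a * u t ^+ 2),
  (fun t => u^`(2)%classic t + 2 * a * u t * u^`()%classic t); split.
  by move=> t Dt /=; rewrite UE // /phi0_pt !(tnth_nth 0).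
move=> t Dt; have [d0 d1 d2 eq3] := hu t Dt.
have h0 := is_derive_derivable d0.
have h1 : is_derive t 1 u^`() (u^`(2) t) := is_derive_derivable d1.
have h2 : is_derive t 1 u^`(2) (u^`(3) t) := is_derive_derivable d2.
split.
- by apply: (is_derive_eq h0); ring.
- by apply: (is_derive_eq (is_deriveD h1 (is_derive_scale_sqr a h0))); ring.
- apply: (is_derive_eq (is_deriveD h2 (is_derive_scale_mul (2 * a) h0 h1))).
  rewrite eq3 (chazy_rhsE _ _ _ (u^`(2)%classic t)).
  by move: (u t) (u^`()%classic t) (u^`(2)%classic t) => c0 c1 c2; ring.
Qed.

Lemma psi0_maps_solutions (delta : C) :
  maps_solutions psi0 (system_xyz delta) (jet_chazyIX delta).
Proof.
move=> D U openD [x [y [z [UE hxyz]]]].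
exists (psi0_pt \o U); last by move=> t _; apply: maps_to_psi0.
(* [x1, x2, x3] are the derivatives that [x] must have on [D]; off [D] they
   need not agree with those of [x], whence the detour through [k1], [k2]. *)
pose x1 t := y t - a * x t ^+ 2.
pose x2 t := z t - 2 * a * x t * x1 t.
have h0 t : D t -> is_derive t 1 x (x1 t).
  by move=> /hxyz[h _ _]; apply: (is_derive_eq h); rewrite /x1; ring.
have h1 t : D t -> is_derive t 1 x1 (x2 t).
  move=> Dt; have [_ hy _] := hxyz t Dt.
  exact: is_derive_eq (is_deriveB hy (is_derive_scale_sqr a (h0 t Dt))) _.
pose x3 t := 54 * x t ^+ 4 + 72 * x t ^+ 2 * x1 t + 12 * x1 t ^+ 2 + delta.
have h2 t : D t -> is_derive t 1 x2 (x3 t).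
  move=> Dt; have [_ _ hz] := hxyz t Dt.
  apply: (is_derive_eq
    (is_deriveB hz (is_derive_scale_mul (2 * a) (h0 t Dt) (h1 t Dt)))).
  by rewrite /x3 (chazy_rhsE delta (x t) (x1 t) (x2 t)) /x2 /x1; ring.
have k1 t : D t -> is_derive t 1 x^`() (x2 t).
  by move=> Dt; apply: (is_derive_derive1 openD Dt h0); apply: h1.
have k2 t : D t -> is_derive t 1 x^`(2) (x3 t).
  by move=> Dt; apply: (is_derive_derive1 openD Dt k1); apply: h2.
have e1 t : D t -> x^`() t = x1 t.
  by move=> /h0/derive1_val.
have e2 t : D t -> x^`(2) t = x2 t.
  by move=> /k1/derive1_val.
exists x => [u' u'' u''' t Dt|t Dt].
  split; [by have [] := h0 t Dt|by have [] := k1 t Dt|by have [] := k2 t Dt|].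
  by rewrite /u' e1 //; exact: derive1_val (k2 t Dt).
by rewrite /comp UE // e1 // e2 // /psi0_pt !(tnth_nth 0).
Qed.

End Transformation.

Theorem theorem6p1 (R : realType) (delta : Cx R) :
  exists psi : ratmap3 (Cx R),
    birational_inverses (phi0 R) psi /\
    maps_solutions (phi0 R) (jet_chazyIX delta) (system_xyz delta) /\
    maps_solutions psi (system_xyz delta) (jet_chazyIX delta).
Proof.
exists (psi0 R); split; first exact: birational_phi0_psi0.
by split; [exact: phi0_maps_solutions|exact: psi0_maps_solutions].
Qed.
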